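(* Let $$s=\sqrt[4]{\tfrac15},\quad \beta=\frac{2\sqrt2\,s^2}{1-2s^2},\quad \gamma=\frac{4\sqrt2}{5s(1-2s^2)},\quad \delta=\frac{60s^4-19}{50s^2(2s^2-1)^2},\quad K=\frac{2}{5s(1-2s^2)}\ (\approx 5.665658792),$$ and for $a\in[0,1]$ let $$\eta(a)=\exp\left[i\left(\tfrac{\pi}{4}+\beta a\right)\right],\quad \chi_1(a)=a+(s+Ka^2)\exp\left[i\left(\tfrac{\pi}{4}+\gamma a+\delta a^2\right)\right],\quad \chi_2(a)=a+(s+Ka^2)\exp\left[i\left(\tfrac{3\pi}{4}+\gamma a-\delta a^2\right)\right],$$ $$q_a(z)=(z-a)(z-\eta(a))(z-i\eta(a))\left[z-\overline{\eta(a)}\right]\left[z+i\overline{\eta(a)}\right]\in S_5,$$ $$s_a(z)=5(z-\chi_1(a))(z-\chi_2(a))\left[z-\overline{\chi_1(a)}\right]\left[z-\overline{\chi_2(a)}\right].$$ Then for all sufficiently small $a>0$ one has $$\Delta(q_a,z^5+z)=\mathcal{O}(a)\quad\text{and}\quad \Delta\left(\frac{q_a'}{5},\frac{s_a}{5}\right)=\mathcal{O}(a^3),$$ so that $d(q_a)=|q_a|_a=s+Ka^2+\mathcal{O}(a^3)$. In particular, the polynomial $z^5+z$ is not locally maximal for Sendov's conjecture.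
   Context: $S_n$ is the set of monic complex polynomials of degree $n$ with all zeros in the closed unit disk, and $Z(p)$ denotes the zero set of $p$. For $\alpha\in\mathbb{C}$, $|p|_\alpha=\min_{w\in Z(p')}|\alpha-w|$, and $d(p)=\max_{z\in Z(p)}|p|_z$. For monic polynomials $p(z)=\prod_{i=1}^n(z-z_i)$ and $q(z)=\prod_{i=1}^n(z-\zeta_i)$ of the same degree $n$, $\Delta(p,q)=\min_{\sigma\in\Sigma_n}\max_{1\le i\le n}|z_i-\zeta_{\sigma(i)}|$, where $\Sigma_n$ is the symmetric group. A polynomial $p\in S_n$ is locally maximal for Sendov's conjecture if there exists $\varepsilon>0$ such that $d(q)\le d(p)$ for all $q\in S_n$ with $\Delta(q,p)<\varepsilon$. The $\mathcal{O}$-terms refer to $a\to0^+$. *)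

(* Defs.v *)
From HB Require Import structures.
From mathcomp Require Export all_boot all_order all_algebra all_fingroup.
From mathcomp Require Export all_classical all_reals all_analysis.
From mathcomp Require Export complex.
Export Order.TTheory GRing.Theory Num.Theory numFieldNormedType.Exports.

#[export] Set Implicit Arguments.
#[export] Unset Strict Implicit.
#[export] Unset Printing Implicit Defensive.

Local Open Scope ring_scope.
Local Open Scope complex_scope.

(* The R-valued modulus; the generic norm on R[i] takes its values in R[i]. *)
Definition modc {R : realType} (z : R[i]) : R := Normc.normc z.

Definition expi {R : realType} (t : R) : R[i] := cos t +i* sin t.

(* The zeros of p listed with multiplicity, in an arbitrary order fixed for
   each p; the list is meaningful only for p != 0. *)
Definition zeros {R : realType} (p : {poly R[i]}) : seq R[i] :=
  sval (closed_field_poly_normal p).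

Lemma zerosE {R : realType} (p : {poly R[i]}) :
  p = lead_coef p *: \prod_(z <- zeros p) ('X - z%:P).
Proof. exact: svalP (closed_field_poly_normal p). Qed.

Lemma mem_zeros {R : realType} (p : {poly R[i]}) z :
  p != 0 -> (z \in zeros p) = root p z.
Proof.
move=> p0; have := zerosE p; set r := zeros p => ->.
by rewrite rootZ ?lead_coef_eq0// root_prod_XsubC.
Qed.

Lemma size_zeros {R : realType} (p : {poly R[i]}) :
  p != 0 -> size (zeros p) = (size p).-1.
Proof.
move=> p0; have := zerosE p; set r := zeros p => ->.
by rewrite size_scale ?lead_coef_eq0// size_prod_XsubC.
Qed.

Definition sendov_class {R : realType} (n : nat) (p : {poly R[i]}) : Prop :=
  [/\ p \is monic, size p = n.+1 & forall z, root p z -> modc z <= 1].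

(* |p|_alpha.  Starting the iterated minimum at the distance to the first zero
   of p' makes it the true minimum as soon as p' has a zero, i.e. deg p >= 2. *)
Definition crit_dist {R : realType} (p : {poly R[i]}) (alpha : R[i]) : R :=
  let ws := zeros p^`() in
  \big[Num.min/modc (alpha - head 0 ws)]_(w <- ws) modc (alpha - w).

Definition sendov_dist {R : realType} (p : {poly R[i]}) : R :=
  \big[Num.max/0]_(z <- zeros p) crit_dist p z.

(* Delta(p, q), for monic p and q of the same degree n.  The maximum is over
   nonnegative reals, and the minimum starts at the value at the identity
   permutation, so both are true extrema (over an empty index set, i.e. for
   n = 0, the maximum is 0). *)
Definition zeros_dist {R : realType} (p q : {poly R[i]}) : R :=
  let n := (size p).-1 in
  let spread (sigma : 'S_n) : R :=
    \big[Num.max/0]_(i < n) modc ((zeros p)`_i - (zeros q)`_(sigma i)) in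
  \big[Num.min/spread 1%g]_(sigma : 'S_n) spread sigma.

(* Meant for p in S_n. *)
Definition locally_maximal {R : realType} (n : nat) (p : {poly R[i]}) : Prop :=
  exists2 eps : R, 0 < eps &
    forall q : {poly R[i]}, sendov_class n q -> zeros_dist q p < eps ->
      sendov_dist q <= sendov_dist p.

Definition cst_s (R : realType) : R := 5^-1 `^ 4^-1.

Definition cst_beta (R : realType) : R :=
  2 * Num.sqrt 2 * cst_s R ^+ 2 / (1 - 2 * cst_s R ^+ 2).

Definition cst_gamma (R : realType) : R :=
  4 * Num.sqrt 2 / (5 * cst_s R * (1 - 2 * cst_s R ^+ 2)).

Definition cst_delta (R : realType) : R :=
  (60 * cst_s R ^+ 4 - 19)
    / (50 * cst_s R ^+ 2 * (2 * cst_s R ^+ 2 - 1) ^+ 2).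

Definition cst_K (R : realType) : R :=
  2 / (5 * cst_s R * (1 - 2 * cst_s R ^+ 2)).

Definition eta {R : realType} (a : R) : R[i] := expi (pi / 4 + cst_beta R * a).

Definition chi1 {R : realType} (a : R) : R[i] :=
  a%:C + (cst_s R + cst_K R * a ^+ 2)%:C
         * expi (pi / 4 + cst_gamma R * a + cst_delta R * a ^+ 2).

Definition chi2 {R : realType} (a : R) : R[i] :=
  a%:C + (cst_s R + cst_K R * a ^+ 2)%:C
         * expi (3 * pi / 4 + cst_gamma R * a - cst_delta R * a ^+ 2).

Definition qpoly {R : realType} (a : R) : {poly R[i]} :=
  ('X - (a%:C)%:P) * ('X - (eta a)%:P) * ('X - ('i%C * eta a)%:P)
  * ('X - ((eta a)^*%C)%:P) * ('X + ('i%C * (eta a)^*%C)%:P).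

Definition spoly {R : realType} (a : R) : {poly R[i]} :=
  5 *: (('X - (chi1 a)%:P) * ('X - (chi2 a)%:P)
        * ('X - ((chi1 a)^*%C)%:P) * ('X - ((chi2 a)^*%C)%:P)).

(* Main.v *)
Require Import Defs.
From mathcomp Require Import ring lra.

(* Write [q_a = (X - a) Q_a] with [Q_a] real and expand [q_a' / 5] and
   [s_a / 5] in powers of [z - a].  The constants beta, gamma, delta and K make
   all coefficients agree up to [O(a^3)], so [q_a' / 5] is [O(a^3)] at the zeros
   chi of [s_a].  These zeros stay away from each other, hence each has its own
   critical point of [q_a] at distance [O(a^3)].  All the chi lie at distance
   exactly [s + K a^2] from [a], while every other zero of [q_a] has a critical
   point at distance close to [1 - s < s]; this gives [d(q_a) = |q_a|_a].  As
   [q_0 = z^5 + z], [K > 0] and [d(q_0) = s], the polynomial [q_0] is not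
   locally maximal. *)

Local Open Scope classical_set_scope.
Local Open Scope ring_scope.
Local Open Scope complex_scope.

(** * Zeros and critical distances *)

(** The gain in [d] is only [K a^2], with no linear term, so the critical points must be located up
    to a cubic error; an error of order [a^2] would hide the gain. No analytic dependence of zeros
    on coefficients is used for this: a monic polynomial that is small at well separated points has
    a zero near each of them, by the size of its linear factors alone. Centring at [a] keeps the
    coefficients tractable: the [chi] have a common modulus there, and conjugation symmetry makes
    all coefficients real, so that only real sines and cosines have to be expanded. The estimates
    are proved on a full neighbourhood of 0 and not only to its right, so that they can be evaluated
    at [a = 0] itself, which yields [d(z^5 + z) = s] without a separate computation. *)

Lemma modc_ge0 (R : realType) (z : R[i]) : 0 <= modc z.
Proof. by case: z => x y; rewrite /modc sqrtr_ge0. Qed.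

Lemma modcM (R : realType) (x y : R[i]) : modc (x * y) = modc x * modc y.
Proof. exact: Normc.normcM. Qed.

Lemma modcN (R : realType) (x : R[i]) : modc (- x) = modc x.
Proof. exact: normcN. Qed.

Lemma modcB (R : realType) (x y : R[i]) : modc (x - y) = modc (y - x).
Proof. by rewrite -modcN opprB. Qed.

Lemma modcD_le (R : realType) (x y : R[i]) : modc (x + y) <= modc x + modc y.
Proof. exact: le_normcD. Qed.

Lemma modcB_le (R : realType) (x y z : R[i]) :
  modc (x - z) <= modc (x - y) + modc (y - z).
Proof. by rewrite -[x - z](subrKA y) modcD_le. Qed.

Lemma modc_real (R : realType) (x : R) : modc x%:C = `|x|.
Proof. by rewrite /modc /= expr0n /= addr0 sqrtr_sqr. Qed.

Lemma modc_Re (R : realType) (z : R[i]) : `|complex.Re z| <= modc z.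
Proof.
case: z => x y; rewrite /modc /= -sqrtr_sqr ler_sqrt ?lerDl ?sqr_ge0//.
by rewrite addr_ge0 ?sqr_ge0.
Qed.

Lemma modc_Im (R : realType) (z : R[i]) : `|complex.Im z| <= modc z.
Proof.
case: z => x y; rewrite /modc /= -sqrtr_sqr ler_sqrt ?lerDr ?sqr_ge0//.
by rewrite addr_ge0 ?sqr_ge0.
Qed.

Lemma modc_le_ReIm (R : realType) (z : R[i]) :
  modc z <= `|complex.Re z| + `|complex.Im z|.
Proof.
case: z => x y; rewrite {1}(_ : x +i* y = x%:C + 'i%C * y%:C); last first.
  by simpc.
apply: le_trans (modcD_le _ _) _; rewrite modcM !modc_real lerD2l.
by rewrite /modc /= expr0n /= add0r expr1n sqrtr1 mul1r.
Qed.

Lemma modc_prod (R : realType) (I : Type) (r : seq I) (F : I -> R[i]) :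
  modc (\prod_(i <- r) F i) = \prod_(i <- r) modc (F i).
Proof.
elim/big_rec2: _ => [|i x y _ <-]; last by rewrite modcM.
by rewrite -[1]/(1%:C) modc_real normr1.
Qed.

Lemma modc_sum (R : realType) (n : nat) (F : 'I_n -> R[i]) :
  modc (\sum_(i < n) F i) <= \sum_(i < n) modc (F i).
Proof.
elim/big_rec2: _ => [|i x y _ xy]; first by rewrite modc_real normr0.
by rewrite (le_trans (modcD_le _ _))// lerD2l.
Qed.

Lemma modcX (R : realType) (z : R[i]) n : modc (z ^+ n) = modc z ^+ n.
Proof.
elim: n => [|n ih]; first by rewrite !expr0 -[1]/(1%:C) modc_real normr1.
by rewrite !exprS modcM ih.
Qed.

Lemma modc_expi (R : realType) (t : R) : modc (expi t) = 1.
Proof. by rewrite /modc /= cos2Dsin2 sqrtr1. Qed.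

Lemma modc_conj (R : realType) (z : R[i]) : modc z^*%C = modc z.
Proof. by case: z => x y; rewrite /modc /= sqrrN. Qed.

Lemma modc_i (R : realType) : modc ('i%C : R[i]) = 1.
Proof. by rewrite /modc /= expr0n expr1n /= add0r sqrtr1. Qed.

Lemma zeros_prod_XsubC (R : realType) (s : seq R[i]) :
  perm_eq (zeros (\prod_(z <- s) ('X - z%:P))) s.
Proof.
apply: prod_XsubC_eq; set p := \prod_(z <- s) _.
by rewrite [RHS]zerosE (monicP (monic_prod_XsubC _ _ _)) scale1r.
Qed.

Lemma perm_eq_ord (T : eqType) (x0 : T) (n : nat) (s t : seq T) :
  size t = n -> perm_eq s t ->
  exists sigma : 'S_n, forall i : 'I_n, nth x0 s i = nth x0 t (sigma i).
Proof.
move=> tn; have /eqP tn' := tn.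
move=> /(@tuple_permP _ _ _ (Tuple tn'))[sigma ->]; exists sigma => i.
by rewrite -tnth_nth tnth_mktuple (tnth_nth x0).
Qed.

Lemma zeros_dist_ge0 (R : realType) (p q : {poly R[i]}) : 0 <= zeros_dist p q.
Proof.
rewrite /zeros_dist; elim/big_rec: _ => [|sigma x _ x0].
  exact: bigmax_ge_id.
by rewrite le_min x0 andbT; apply: bigmax_ge_id.
Qed.

Lemma zeros_dist_le (R : realType) (s t : seq R[i]) (e : R) :
  size s = size t -> 0 <= e ->
  (forall i, (i < size s)%N -> modc (s`_i - t`_i) <= e) ->
  zeros_dist (\prod_(z <- s) ('X - z%:P)) (\prod_(z <- t) ('X - z%:P)) <= e.
Proof.
move=> st e0 he; rewrite /zeros_dist size_prod_XsubC /=.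
have [f fE] := perm_eq_ord 0 erefl (zeros_prod_XsubC s).
have [g gE] := perm_eq_ord 0 (esym st) (zeros_prod_XsubC t).
(* [f] and [g] undo the unspecified orders chosen by [zeros]: through [f * g^-1], the zero [s_(f i)]
   is matched with [t_(f i)]. *)
apply: le_trans (bigmin_le _ (f * g^-1)%g _) _.
apply: bigmax_le => // i _.
by rewrite fE gE permM permKV he.
Qed.

(* Each [c_j] has a zero of [P] within [m]; as the [c_j] are [3m]-separated,
   these zeros are distinct, hence exhaust the zeros of [P], and all factors
   but one of [P.[c_j]] have modulus at least [m]. *)
Lemma monic_zeros_near (R : realType) (P : {poly R[i]}) (cs : seq R[i])
    (m e : R) :
  P \is monic -> size P = (size cs).+1 -> 0 < m ->
  (forall i j, (i < j < size cs)%N -> 3 * m <= modc (cs`_i - cs`_j)) ->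
  (forall i, (i < size cs)%N -> modc P.[cs`_i] <= e) ->
  e < m ^+ size cs ->
  exists ws, [/\ size ws = size cs, P = \prod_(w <- ws) ('X - w%:P) &
    forall i, (i < size cs)%N -> modc (cs`_i - ws`_i) <= e / m ^+ (size cs).-1].
Proof.
move=> Pmon sP m0 sep he em; set n := size cs.
have {}sep (i j : 'I_n) : i != j -> 3 * m <= modc (cs`_i - cs`_j).
  move=> ij; case: (ltngtP i j) => [lt|lt|/val_inj /eqP].
  - by apply: sep; rewrite lt ltn_ord.
  - by rewrite modcB; apply: sep; rewrite lt ltn_ord.
  - by rewrite (negPf ij).
have P0 : P != 0 by rewrite monic_neq0.
have sz : size (zeros P) = n by rewrite size_zeros// sP.
have PE : P = \prod_(k < n) ('X - ((zeros P)`_k)%:P).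
  by rewrite {1}[P]zerosE (monicP Pmon) scale1r (big_nth 0) big_mkord sz.
have PcE (i : 'I_n) :
    modc P.[cs`_i] = \prod_(k < n) modc (cs`_i - (zeros P)`_k).
  rewrite {1}PE horner_prod modc_prod.
  by apply: eq_bigr => k _; rewrite !hornerE.
have near (i : 'I_n) : exists k : 'I_n, modc (cs`_i - (zeros P)`_k) < m.
  apply/existsP; apply: contraLR em; rewrite negb_exists => /forallP far.
  rewrite -leNgt (le_trans _ (he i (ltn_ord i)))// PcE.
  rewrite -[X in m ^+ X]card_ord -prodr_const; apply: ler_prod => k _.
  by rewrite (ltW m0) leNgt far.
have [f fP] := fin_all_exists near.
have f_inj : injective f.
  move=> i j fij; apply: contraTeq isT => /sep; apply: contraLR => _.
  rewrite -ltNge (le_lt_trans (modcB_le _ (zeros P)`_(f i) _))//.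
  by have := fP i; have := fP j; rewrite fij [modc (_ - cs`_j)]modcB; lra.
exists [seq (zeros P)`_(f i) | i : 'I_n]; split.
- by rewrite size_image card_ord.
- by rewrite big_image [LHS]PE [LHS](reindex_inj f_inj).
move=> i' ni; pose i := Ordinal ni.
have -> : [seq (zeros P)`_(f i) | i : 'I_n]`_i' = (zeros P)`_(f i).
  by rewrite (nth_map i) ?size_enum_ord// -[i']/(val i) nth_ord_enum.
rewrite ler_pdivlMr ?exprn_gt0// (le_trans _ (he _ ni))// (PcE i).
rewrite (bigD1 (f i))//= ler_wpM2l ?modc_ge0//.
have -> : n.-1 = #|predC1 (f i)| by rewrite cardC1 card_ord.
rewrite -prodr_const; apply: ler_prod => k ki; rewrite (ltW m0)/=.
have [j kE] : exists j, f j = k by exists (invF f_inj k); rewrite f_invF.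
have ij : i != j by apply: contraNneq ki => ->; rewrite kE.
have := sep _ _ ij; have := modcB_le cs`_i (zeros P)`_k cs`_j.
by have := fP j; rewrite kE [modc (cs`_j - _)]modcB; lra.
Qed.

Lemma crit_dist_le (R : realType) (p : {poly R[i]}) (alpha w : R[i]) :
  p^`() != 0 -> root p^`() w -> crit_dist p alpha <= modc (alpha - w).
Proof.
move=> p0; rewrite -mem_zeros// /crit_dist; move: (zeros _) (head _ _).
move=> ws h; elim: ws => // v ws ih; rewrite inE big_cons ge_min.
by case/orP => [/eqP->|/ih->]; rewrite ?lexx ?orbT.
Qed.

Lemma crit_dist_ge0 (R : realType) (p : {poly R[i]}) (alpha : R[i]) :
  0 <= crit_dist p alpha.
Proof.
rewrite /crit_dist; elim/big_rec: _ => [|w x _ x0]; first exact: modc_ge0.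
by rewrite le_min x0 modc_ge0.
Qed.

Lemma crit_dist_ge (R : realType) (p : {poly R[i]}) (alpha : R[i]) (e : R) :
  (1 < size p^`())%N ->
  (forall w, root p^`() w -> e <= modc (alpha - w)) -> e <= crit_dist p alpha.
Proof.
move=> sp he.
have p0 : p^`() != 0 by rewrite -size_poly_gt0 (ltn_trans _ sp).
have : forall w, w \in zeros p^`() -> e <= modc (alpha - w).
  by move=> w; rewrite mem_zeros//; apply: he.
(* Since the list is not empty, the starting value of the minimum is the distance to a genuine
   critical point. *)
have : (0 < size (zeros p^`()))%N by rewrite size_zeros// -subn1 subn_gt0.
rewrite /crit_dist; case: (zeros _) => // v ws _ hv.
rewrite big_seq; elim/big_rec: _ => [|w x /hv wv x0].
  by apply: hv; rewrite mem_head.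
by rewrite le_min x0 wv.
Qed.

Lemma sendov_dist_le (R : realType) (p : {poly R[i]}) (e : R) :
  p != 0 -> 0 <= e -> (forall z, root p z -> crit_dist p z <= e) ->
  sendov_dist p <= e.
Proof.
move=> p0 e0 he; rewrite /sendov_dist big_seq.
elim/big_rec: _ => // z x zp xe; rewrite ge_max xe andbT.
by apply: he; rewrite -mem_zeros.
Qed.

Lemma sendov_dist_ge (R : realType) (p : {poly R[i]}) z :
  p != 0 -> root p z -> crit_dist p z <= sendov_dist p.
Proof.
move=> p0; rewrite -mem_zeros// /sendov_dist.
elim: (zeros p) => // v ws ih; rewrite inE big_cons le_max.
by case/orP => [/eqP->|/ih->]; rewrite ?lexx ?orbT.
Qed.

(** * Second order expansions at 0 *)

(** This drives a bootstrap: [sin x <= x], then [1 - x^2/2 <= cos x], then [x - x^3/6 <= sin x],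
    each inequality being the derivative of the next. *)
Lemma ge0_derive_ge0 (R : realType) (f df : R -> R) :
  (forall x : R, is_derive x 1 f (df x)) -> f 0 = 0 ->
  (forall x, 0 <= x -> 0 <= df x) -> forall x, 0 <= x -> 0 <= f x.
Proof.
move=> fdf f0 df0 x x0.
have cf : continuous f.
  by move=> y; apply/differentiable_continuous/derivable1_diffP; case: (fdf y).
have [c] := MVT_segment x0 (fun y _ => fdf y) (continuous_subspaceT cf).
rewrite in_itv /= f0 !subr0 => /andP[c0 _] ->.
by rewrite mulr_ge0 ?df0.
Qed.

Lemma sin_le_id (R : realType) (x : R) : 0 <= x -> sin x <= x.
Proof.
rewrite -[sin x <= x]subr_ge0; move: x.
apply: (@ge0_derive_ge0 R (fun x => x - sin x) (fun x => 1 - cos x)).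
- by rewrite sin0 subr0.
- by move=> y _; rewrite subr_ge0 cos_le1.
Qed.

Lemma cos_half (R : realType) (x : R) : cos x = 1 - 2 * sin (x / 2) ^+ 2.
Proof.
by rewrite {1}(splitr x) cosD -!expr2 cos2sin2; ring.
Qed.

Lemma cos_ge_sub (R : realType) (x : R) : 0 <= x -> 1 - x ^+ 2 / 2 <= cos x.
Proof.
move=> x0; rewrite -subr_ge0; move: x x0.
apply: (@ge0_derive_ge0 R (fun x => cos x - (1 - x ^+ 2 / 2))
  (fun x => x - sin x)).
- move=> y; apply: is_derive_eq; rewrite /GRing.scale /=; field => //.
- by rewrite cos0; ring.
- by move=> y y0; rewrite subr_ge0 sin_le_id.
Qed.

Lemma sin_ge_sub (R : realType) (x : R) : 0 <= x -> x - x ^+ 3 / 6 <= sin x.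
Proof.
move=> x0; rewrite -subr_ge0; move: x x0.
apply: (@ge0_derive_ge0 R (fun x => sin x - (x - x ^+ 3 / 6))
  (fun x => cos x - (1 - x ^+ 2 / 2))).
- move=> y; apply: is_derive_eq; rewrite /GRing.scale /=; field => //.
- by rewrite sin0; ring.
- by move=> y y0; rewrite subr_ge0 cos_ge_sub.
Qed.

Lemma sin_remainder (R : realType) (x : R) : `|sin x - x| <= `|x| ^+ 3.
Proof.
wlog x0 : x / 0 <= x => [wl|].
  have [/wl//|x0] := leP 0 x.
  rewrite -(normrN x) -(normrN (_ - _)) opprD opprK -sinN -{2}[x]opprK.
  by apply: wl; lra.
have := sin_le_id x0; have := sin_ge_sub x0.
rewrite (ger0_norm x0) => h1 h2; have x3 : 0 <= x ^+ 3 by exact: exprn_ge0.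
by rewrite ler_norml; apply/andP; split; lra.
Qed.

(** The half-angle formula reduces this to the sine: for [x >= 0], [y = x / 2] and [s = sin y], the
    difference is [2 (y - s)(y + s)], where [y - s <= y^3/6] and [y + s <= 2 y]. *)
Lemma cos_remainder (R : realType) (x : R) :
  `|cos x - (1 - x ^+ 2 / 2)| <= `|x| ^+ 4.
Proof.
wlog x0 : x / 0 <= x => [wl|].
  have [/wl//|x0] := leP 0 x.
  by rewrite -(normrN x) -cosN -sqrrN; apply: wl; lra.
have y0 : 0 <= x / 2 by lra.
rewrite (ger0_norm x0) cos_half.
have := sin_geN1 (x / 2); have := sin_le_id y0; have := sin_ge_sub y0.
have -> : x = 2 * (x / 2) by field.
rewrite mulrAC divff// mul1r.
move: (x / 2) (sin _) y0 => {x x0} y s y0 ge_s le_s s_geN1.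
(* Up to [y = 1] the cubic lower bound of the sine suffices; beyond it, [-1 <= s] does. *)
have ge_Ns : - y <= s by have [|] := leP y 1; nra.
have y3 : 0 <= y ^+ 3 by exact: exprn_ge0.
have y4 : 0 <= y ^+ 4 by exact: exprn_ge0.
have le_prod : (y - s) * (y + s) <= y ^+ 3 / 6 * (2 * y).
  by apply: ler_pM; lra.
have ge_prod : 0 <= (y - s) * (y + s) by rewrite mulr_ge0; lra.
rewrite ler_norml; apply/andP; split; nra.
Qed.

Lemma cos_pi4 (R : realType) : cos (pi / 4) = Num.sqrt 2 / 2 :> R.
Proof.
have c2 : cos (pi / 4) ^+ 2 = 2^-1 :> R.
  have := cos_half (pi / 2 : R); rewrite cos_pihalf.
  rewrite (_ : pi / 2 / 2 = pi / 4); last by field.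
  by rewrite cos2sin2; lra.
have c0 : 0 <= cos (pi / 4) :> R.
  by apply: cos_ge0_pihalf; have := pi_ge0 R; lra.
apply/eqP; rewrite -(eqrXn2 (n := 2))// ?divr_ge0 ?sqrtr_ge0//.
by rewrite c2 expr_div_n sqr_sqrtr//; apply/eqP; field.
Qed.

Lemma sin_pi4 (R : realType) : sin (pi / 4) = Num.sqrt 2 / 2 :> R.
Proof. by rewrite -cosBpihalf -cosN -cos_pi4; congr cos; field. Qed.

(** * Calculus of second order expansions with cubic remainder *)

Definition bounded0 {R : realType} (h : R -> R) : Prop :=
  exists C, \forall a \near (0 : R), `|h a| <= C.

Lemma bounded0_cst (R : realType) (c : R) : bounded0 (fun=> c).
Proof. by exists `|c|; near=> a. Unshelve. all: by end_near. Qed.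

Lemma bounded0_id (R : realType) : bounded0 (fun a : R => a).
Proof.
exists 1; near=> a; apply: ltW; near: a.
by apply: (nbhs0_lt (V := R)).
Unshelve. all: by end_near. Qed.

Lemma bounded0D (R : realType) (f g : R -> R) :
  bounded0 f -> bounded0 g -> bounded0 (fun a => f a + g a).
Proof.
move=> [C fC] [D gD]; exists (C + D); apply: filterS2 fC gD => a fa ga.
by rewrite (le_trans (ler_normD _ _))// lerD.
Qed.

Lemma bounded0M (R : realType) (f g : R -> R) :
  bounded0 f -> bounded0 g -> bounded0 (fun a => f a * g a).
Proof.
move=> [C fC] [D gD]; exists (C * D); apply: filterS2 fC gD => a fa ga.
by rewrite normrM ler_pM.
Qed.

Lemma bounded0X (R : realType) (f : R -> R) n :
  bounded0 f -> bounded0 (fun a => f a ^+ n).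
Proof.
move=> bf; elim: n => [|n ih].
  by under eq_fun do rewrite expr0; exact: bounded0_cst.
by under eq_fun do rewrite exprS; exact: bounded0M.
Qed.

(** The identity is required for every [a] and only the bound on [h] is local, so that sums and
    products of expansions reduce to [ring] identities. *)
Definition taylor2 {R : realType} (f : R -> R) (c0 c1 c2 : R) : Prop :=
  exists2 h : R -> R, bounded0 h &
    forall a, f a = c0 + c1 * a + c2 * a ^+ 2 + h a * a ^+ 3.

Lemma taylor2_poly (R : realType) (c0 c1 c2 : R) :
  taylor2 (fun a => c0 + c1 * a + c2 * a ^+ 2) c0 c1 c2.
Proof. by exists (fun=> 0) => [|a]; [exact: bounded0_cst | ring]. Qed.

(** An expansion assembled from the rules below carries unsimplified coefficients; this turns their
    simplification into separate scalar equations. *)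
Lemma taylor2_eq (R : realType) (f g : R -> R) (c0 c1 c2 d0 d1 d2 : R) :
  taylor2 f c0 c1 c2 -> f =1 g -> c0 = d0 -> c1 = d1 -> c2 = d2 ->
  taylor2 g d0 d1 d2.
Proof. by move=> [h bh fE] fg <- <- <-; exists h => // a; rewrite -fg. Qed.

Lemma taylor2_id (R : realType) : taylor2 (fun a : R => a) 0 1 0.
Proof. by apply: (taylor2_eq (taylor2_poly 0 1 0)) => // a; ring. Qed.

Lemma taylor2D (R : realType) (f g : R -> R) (c0 c1 c2 d0 d1 d2 : R) :
  taylor2 f c0 c1 c2 -> taylor2 g d0 d1 d2 ->
  taylor2 (fun a => f a + g a) (c0 + d0) (c1 + d1) (c2 + d2).
Proof.
move=> [h bh fE] [k bk gE]; exists (fun a => h a + k a) => [|a].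
  exact: bounded0D.
by rewrite fE gE; ring.
Qed.

Lemma taylor2M (R : realType) (f g : R -> R) (c0 c1 c2 d0 d1 d2 : R) :
  taylor2 f c0 c1 c2 -> taylor2 g d0 d1 d2 ->
  taylor2 (fun a => f a * g a) (c0 * d0) (c0 * d1 + c1 * d0)
    (c0 * d2 + c1 * d1 + c2 * d0).
Proof.
move=> [h bh fE] [k bk gE].
exists (fun a => c1 * d2 + c2 * d1 + c2 * d2 * a + h a * k a * a ^+ 3
  + (c0 + c1 * a + c2 * a ^+ 2) * k a
  + (d0 + d1 * a + d2 * a ^+ 2) * h a) => [|a].
  by do ![exact: bounded0_cst | exact: bounded0_id | exact: bh | exact: bk
    | apply: bounded0D | apply: bounded0X | apply: bounded0M].
by rewrite fE gE; ring.
Qed.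

Lemma taylor2Z (R : realType) (k : R) (f : R -> R) (c0 c1 c2 : R) :
  taylor2 f c0 c1 c2 -> taylor2 (fun a => k * f a) (k * c0) (k * c1) (k * c2).
Proof.
move=> [h bh fE]; exists (fun a => k * h a) => [|a].
  by apply: bounded0M => //; exact: bounded0_cst.
by rewrite fE; ring.
Qed.

Lemma taylor2_sin (R : realType) (f : R -> R) (c1 c2 : R) :
  taylor2 f 0 c1 c2 -> taylor2 (fun a => sin (f a)) 0 c1 c2.
Proof.
move=> [h bh fE]; pose k (x : R) := (sin x - x) / x ^+ 3.
(* At [x = 0] the quotient is 0 by the convention on division, and the identity still holds. *)
have kE x : sin x = x + k x * x ^+ 3.
  rewrite /k; have [->|x0] := eqVneq x 0; first by rewrite sin0; ring.
  by field.
have k1 x : `|k x| <= 1.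
  rewrite /k; have [->|x0] := eqVneq x 0.
    by rewrite sin0 subrr mul0r normr0 ler01.
  by rewrite normrM normfV normrX ler_pdivrMr ?exprn_gt0 ?normr_gt0// mul1r
    sin_remainder.
exists (fun a => h a + k (f a) * (c1 + c2 * a + h a * a ^+ 2) ^+ 3) => [|a].
  have bk : bounded0 (fun a => k (f a)) by exists 1; near=> a.
  by do ![exact: bounded0_cst | exact: bounded0_id | exact: bh | exact: bk
    | apply: bounded0D | apply: bounded0X | apply: bounded0M].
by rewrite kE {1 3}fE; ring.
Unshelve. all: by end_near. Qed.

Lemma taylor2_cos (R : realType) (f : R -> R) (c1 c2 : R) :
  taylor2 f 0 c1 c2 -> taylor2 (fun a => cos (f a)) 1 0 (- c1 ^+ 2 / 2).
Proof.
move=> [h bh fE]; pose k (x : R) := (cos x - (1 - x ^+ 2 / 2)) / x ^+ 4.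
have kE x : cos x = 1 - x ^+ 2 / 2 + k x * x ^+ 4.
  rewrite /k; have [->|x0] := eqVneq x 0; first by rewrite cos0; ring.
  by field.
have k1 x : `|k x| <= 1.
  rewrite /k; have [->|x0] := eqVneq x 0.
    by rewrite cos0 expr0n /= mul0r subr0 subrr mul0r normr0 ler01.
  by rewrite normrM normfV normrX ler_pdivrMr ?exprn_gt0 ?normr_gt0// mul1r
    cos_remainder.
exists (fun a => - (c1 * (c2 + h a * a) + a * (c2 + h a * a) ^+ 2 / 2)
    + k (f a) * (a * (c1 + c2 * a + h a * a ^+ 2) ^+ 4)) => [|a].
  have bk : bounded0 (fun a => k (f a)) by exists 1; near=> a.
  under eq_fun do rewrite -mulN1r.
  by do ![exact: bounded0_cst | exact: bounded0_id | exact: bh | exact: bk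
    | apply: bounded0D | apply: bounded0X | apply: bounded0M].
by rewrite kE; set K := k (f a); rewrite fE; field.
Unshelve. all: by end_near. Qed.

Lemma taylor2_near (R : realType) (f : R -> R) (c0 c1 c2 : R) :
  taylor2 f c0 c1 c2 ->
  exists2 C, 0 < C & \forall a \near (0 : R), `|f a - c0| <= C * `|a|.
Proof.
move=> [h bh fE].
have : bounded0 (fun a => c1 + c2 * a + h a * a ^+ 2).
  by do ![exact: bounded0_cst | exact: bounded0_id | exact: bh
    | apply: bounded0D | apply: bounded0X | apply: bounded0M].
(* The maximum with 1 makes the constant positive, as later divisions by it require. *)
move=> [C bC]; exists (Num.max 1 C); first by rewrite lt_max ltr01.
apply: filterS bC => a aC; rewrite fE.
rewrite (_ : _ - c0 = (c1 + c2 * a + h a * a ^+ 2) * a); last by ring.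
by rewrite normrM ler_wpM2r// le_max aC orbT.
Qed.

Lemma taylor2_continuous (R : realType) (f : R -> R) (c0 c1 c2 e : R) :
  0 < e -> taylor2 f c0 c1 c2 -> \forall a \near (0 : R), `|f a - c0| < e.
Proof.
move=> e0 /taylor2_near[C C0 fC]; near=> a.
have ha : `|f a - c0| <= C * `|a| by near: a.
apply: (le_lt_trans ha); rewrite mulrC -ltr_pdivlMr//; near: a.
by apply: (nbhs0_lt (V := R)); rewrite divr_gt0.
Unshelve. all: by end_near. Qed.

Lemma taylor2_O3 (R : realType) (f : R -> R) :
  taylor2 f 0 0 0 ->
  exists2 C, 0 < C & \forall a \near (0 : R), `|f a| <= C * `|a| ^+ 3.
Proof.
move=> [h [C bC] fE]; exists (Num.max 1 C); first by rewrite lt_max ltr01.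
apply: filterS bC => a aC; rewrite fE !mul0r !add0r normrM normrX.
by rewrite ler_wpM2r// le_max aC orbT.
Qed.

(** * The polynomials [q_a] and [s_a] *)

Lemma cst_s_ge0 (R : realType) : 0 <= cst_s R.
Proof. exact: powR_ge0. Qed.

Lemma cst_s4 (R : realType) : cst_s R ^+ 4 = 5^-1.
Proof.
by rewrite -powR_mulrn ?powR_ge0// -powRrM mulVf// powRr1.
Qed.

Lemma cst_s_bounds (R : realType) : 2 / 3 < cst_s R < 7 / 10.
Proof.
have s4 := cst_s4 R; have s0 := cst_s_ge0 R.
by apply/andP; split; rewrite -(ltr_pXn2r (n := 4)) ?nnegrE ?s4//; lra.
Qed.

Lemma subs2_gt0 (R : realType) : 0 < 1 - 2 * cst_s R ^+ 2.
Proof.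
have : cst_s R ^+ 2 < 1 / 2.
  rewrite -(ltr_pXn2r (n := 2)) ?nnegrE ?sqr_ge0//.
  by rewrite -exprM cst_s4; lra.
by lra.
Qed.

Lemma sqrt2_bounds (R : realType) : 7 / 5 < (Num.sqrt 2 : R) < 10 / 7.
Proof.
have q2 : Num.sqrt 2 ^+ 2 = 2 :> R by rewrite sqr_sqrtr.
have q0 : 0 <= Num.sqrt 2 :> R by exact: sqrtr_ge0.
by apply/andP; split; rewrite -(ltr_pXn2r (n := 2)) ?nnegrE ?q2//; lra.
Qed.

Lemma inv_cst_s (R : realType) : (cst_s R)^-1 = 5 * cst_s R ^+ 3.
Proof.
have /andP[s0 _] := cst_s_bounds R; have s4 := cst_s4 R.
apply: (mulfI (x := cst_s R)); first by lra.
by rewrite mulfV; lra.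
Qed.

(* [(1 - 2 s^2)(1 + 2 s^2) = 1/5], so all constants are polynomials in [s] and
   [sqrt 2]. *)
Lemma inv_1m2s2 (R : realType) :
  (1 - 2 * cst_s R ^+ 2)^-1 = 5 * (1 + 2 * cst_s R ^+ 2).
Proof.
have s4 := cst_s4 R; have /andP[s0 s1] := cst_s_bounds R.
have d0 := subs2_gt0 R.
apply: (mulfI (x := 1 - 2 * cst_s R ^+ 2)); first by lra.
by rewrite mulfV; lra.
Qed.

Lemma cst_betaE (R : realType) :
  cst_beta R = Num.sqrt 2 * (4 + 10 * cst_s R ^+ 2).
Proof.
have s4 := cst_s4 R.
rewrite /cst_beta inv_1m2s2.
(* Writing 4 as [20 * 5^-1] lets [5^-1] be replaced by [s^4], after which both sides agree as
   polynomials in [s]. *)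
rewrite [RHS](_ : _ = Num.sqrt 2 * (20 * 5^-1 + 10 * cst_s R ^+ 2)).
  by rewrite -s4; ring.
by field.
Qed.

Lemma cst_gammaE (R : realType) :
  cst_gamma R = Num.sqrt 2 * (8 * cst_s R + 20 * cst_s R ^+ 3).
Proof.
have s4 := cst_s4 R.
rewrite /cst_gamma !invfM inv_cst_s inv_1m2s2.
rewrite [RHS](_ : _ = Num.sqrt 2 * (40 * cst_s R * 5^-1 + 20 * cst_s R ^+ 3)).
  by rewrite -[in RHS]s4; field.
by field.
Qed.

Lemma cst_KE (R : realType) : cst_K R = 4 * cst_s R + 10 * cst_s R ^+ 3.
Proof.
have s4 := cst_s4 R.
rewrite /cst_K !invfM inv_cst_s inv_1m2s2.
rewrite [RHS](_ : _ = 20 * cst_s R * 5^-1 + 10 * cst_s R ^+ 3).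
  by rewrite -[in RHS]s4; field.
by field.
Qed.

Lemma cst_deltaE (R : realType) : cst_delta R = - 14 - 63 / 2 * cst_s R ^+ 2.
Proof.
have s4 := cst_s4 R.
have /andP[s0 s1] := cst_s_bounds R.
have d0 := subs2_gt0 R.
have -> : cst_delta R = (60 * cst_s R ^+ 4 - 19) / 50 * (cst_s R)^-1 ^+ 2
    * (1 - 2 * cst_s R ^+ 2)^-1 ^+ 2.
  by rewrite /cst_delta; field; apply/and3P; split; lra.
rewrite inv_cst_s inv_1m2s2 s4.
(* The powers of [s] are grouped around [s^4] so that its value can be substituted. *)
have -> : (60 / 5 - 19) / 50 * (5 * cst_s R ^+ 3) ^+ 2
    * (5 * (1 + 2 * cst_s R ^+ 2)) ^+ 2
  = - (7 / 50) * 625 * (cst_s R ^+ 4 * cst_s R ^+ 2 + 4 * (cst_s R ^+ 4) ^+ 2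
      + 4 * (cst_s R ^+ 4) ^+ 2 * cst_s R ^+ 2) by field.
by rewrite s4; field.
Qed.

(** * The two quartics in powers of [z - a] *)

Definition theta {R : realType} (a : R) : R := pi / 4 + cst_beta R * a.
Definition radius {R : realType} (a : R) : R := cst_s R + cst_K R * a ^+ 2.
Definition phi1 {R : realType} (a : R) : R :=
  pi / 4 + cst_gamma R * a + cst_delta R * a ^+ 2.
Definition phi2 {R : realType} (a : R) : R :=
  3 * pi / 4 + cst_gamma R * a - cst_delta R * a ^+ 2.

Definition etas {R : realType} (a : R) : seq R[i] :=
  [:: a%:C; eta a; 'i%C * eta a; (eta a)^*%C; - ('i%C * (eta a)^*%C)].

Definition chis {R : realType} (a : R) : seq R[i] :=
  [:: chi1 a; chi2 a; (chi1 a)^*%C; (chi2 a)^*%C].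

Lemma qpoly_prod (R : realType) (a : R) :
  qpoly a = \prod_(z <- etas a) ('X - z%:P).
Proof.
by rewrite /qpoly /etas !big_cons big_nil mulr1 rmorphN /= opprK !mulrA.
Qed.

Lemma spoly_prod (R : realType) (a : R) :
  5^-1 *: spoly a = \prod_(z <- chis a) ('X - z%:P).
Proof.
by rewrite /spoly /chis !big_cons big_nil mulr1 scalerA mulVf ?scale1r ?mulrA.
Qed.

(* [qcoef a] and [scoef a] list the coefficients below degree 4 of [q_a' / 5]
   and [s_a / 5] in powers of [z - a]. *)
Definition qcoef {R : realType} (a : R) : seq R :=
  let x := cos (theta a) in let y := sin (theta a) in
  let u := y - x in let v := 2 - 4 * x * y in
  [:: (a ^+ 4 + 2 * u * a ^+ 3 + v * a ^+ 2 + 2 * u * a + 1) / 5;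
      2 / 5 * (4 * a ^+ 3 + 6 * u * a ^+ 2 + 2 * v * a + 2 * u);
      3 / 5 * (6 * a ^+ 2 + 6 * u * a + v);
      4 / 5 * (4 * a + 2 * u)].

Definition scoef {R : realType} (a : R) : seq R :=
  let r := radius a in let c1 := cos (phi1 a) in let c2 := cos (phi2 a) in
  [:: r ^+ 4; - (2 * r ^+ 3 * (c1 + c2)); 2 * r ^+ 2 + 4 * r ^+ 2 * c1 * c2;
      - (2 * r * (c1 + c2))].

Lemma XsubC_mul (K : comNzRingType) (c d : K) :
  ('X - c%:P) * ('X - d%:P) = 'X^2 - (c + d)%:P * 'X + (c * d)%:P.
Proof. by rewrite rmorphD rmorphM /=; ring. Qed.

(** The zeros pair off by conjugation, [- i conj(eta)] being the conjugate of [i eta]; both constant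
    terms are 1 because [eta] has modulus 1. *)
Lemma qpoly_quad (R : realType) (a : R) :
  qpoly a = ('X - a%:C%:P) * ('X^2 - ((2 * cos (theta a))%:C)%:P * 'X + 1)
    * ('X^2 + ((2 * sin (theta a))%:C)%:P * 'X + 1).
Proof.
set x := cos _; set y := sin _.
have xy : x ^+ 2 + y ^+ 2 = 1 by exact: cos2Dsin2.
have etaE : eta a = x +i* y by [].
transitivity (('X - a%:C%:P) * (('X - (eta a)%:P) * ('X - ((eta a)^*%C)%:P))
  * (('X - ('i%C * eta a)%:P) * ('X - (- ('i%C * (eta a)^*%C))%:P))).
  by rewrite /qpoly rmorphN /= opprK; ring.
have sumE : eta a + (eta a)^*%C = (2 * x)%:C.
  by rewrite etaE; simpc; rewrite -mulr2n mulr_natl.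
have prodE : eta a * (eta a)^*%C = 1.
  rewrite etaE; simpc; rewrite -!expr2 xy [y * x]mulrC addNr.
  by [].
have isumE : 'i%C * eta a + - ('i%C * (eta a)^*%C) = - (2 * y)%:C.
  by rewrite etaE; simpc; rewrite -opprD -mulr2n mulr_natl.
have iprodE : 'i%C * eta a * - ('i%C * (eta a)^*%C) = 1.
  by rewrite mulrN mulrACA prodE mulr1 -expr2 sqr_i opprK.
congr (_ * _ * _).
  by rewrite (XsubC_mul (eta a) ((eta a)^*%C)) sumE prodE polyC1.
rewrite (XsubC_mul ('i%C * eta a) (- ('i%C * (eta a)^*%C))) isumE iprodE.
by rewrite polyC1 polyCN mulNr opprK.
Qed.

Lemma deriv_quad_horner (K : comNzRingType) (a b c z : K) :
  (('X - a%:P) * ('X^2 - b%:P * 'X + 1) * ('X^2 + c%:P * 'X + 1))^`().[z]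
  = (z ^+ 2 - b * z + 1) * (z ^+ 2 + c * z + 1)
    + (z - a) * ((2 * z - b) * (z ^+ 2 + c * z + 1)
                 + (z ^+ 2 - b * z + 1) * (2 * z + c)).
Proof.
rewrite !(derivM, derivD, derivB, derivN, derivXn, derivX, derivC).
by rewrite !hornerE /=; ring.
Qed.

(** For [q = (X - a) Q], the coefficient of [(z - a)^i] in [q'] is [(i + 1) Q^(i)(a) / i!]; here
    [Q = X^4 + 2u X^3 + v X^2 + 2u X + 1] with the [u] and [v] of [qcoef]. *)
Lemma qpoly_deriv_horner (R : realType) (a : R) (z : R[i]) :
  (5^-1 *: (qpoly a)^`()).[z] = (z - a%:C) ^+ 4
    + \sum_(i < 4) ((qcoef a)`_i)%:C * (z - a%:C) ^+ i.
Proof.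
rewrite qpoly_quad hornerZ deriv_quad_horner.
rewrite !big_ord_recr big_ord0 /=.
move: (cos _) (sin _) => x y.
by field.
Qed.

Lemma polar_quadratic (R : realType) (r t : R) (w : R[i]) :
  w = r%:C * expi t \/ w = r%:C * (expi t)^*%C ->
  w ^+ 2 - (2 * r * cos t)%:C * w + (r ^+ 2)%:C = 0.
Proof.
have ct := sin2cos2 t; rewrite /expi.
case=> ->; rewrite expr2; simpc; apply/eqP; rewrite eq_complex /=;
  (apply/andP; split; apply/eqP); ring: ct.
Qed.

Lemma scoef_root (R : realType) (a : R) (z : R[i]) :
  z \in chis a ->
  (z - a%:C) ^+ 4 + \sum_(i < 4) ((scoef a)`_i)%:C * (z - a%:C) ^+ i = 0.
Proof.
rewrite !big_ord_recr big_ord0 /= => zc; set w := z - a%:C.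
set r := radius a; set c1 := cos (phi1 a); set c2 := cos (phi2 a).
transitivity ((w ^+ 2 - (2 * r * c1)%:C * w + (r ^+ 2)%:C)
  * (w ^+ 2 - (2 * r * c2)%:C * w + (r ^+ 2)%:C)); first by ring.
have conjE t : (a%:C + r%:C * expi t)^*%C - a%:C = r%:C * (expi t)^*%C.
  by rewrite /expi; simpc; rewrite [a + _]addrC addrK.
move: zc; rewrite !inE => /or4P[] /eqP zE; rewrite /w zE.
- by rewrite [X in X * _]polar_quadratic ?mul0r//; left; rewrite addrC addKr.
- by rewrite [X in _ * X]polar_quadratic ?mulr0//; left; rewrite addrC addKr.
- by rewrite [X in X * _]polar_quadratic ?mul0r//; right; rewrite conjE.
- by rewrite [X in _ * X]polar_quadratic ?mulr0//; right; rewrite conjE.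
Qed.

(** * Expansion and matching of the coefficients *)

Lemma taylor2_cos_pi4 (R : realType) (f : R -> R) (c1 c2 : R) :
  taylor2 f 0 c1 c2 ->
  taylor2 (fun a => cos (pi / 4 + f a)) (Num.sqrt 2 / 2)
    (Num.sqrt 2 / 2 * - c1) (Num.sqrt 2 / 2 * - (c1 ^+ 2 / 2 + c2)).
Proof.
move=> hf; apply: (taylor2_eq (taylor2Z (Num.sqrt 2 / 2)
  (taylor2D (taylor2_cos hf) (taylor2Z (-1) (taylor2_sin hf))))) => [a|||].
- by rewrite cosD cos_pi4 sin_pi4; ring.
- by ring.
- by ring.
- by field.
Qed.

Lemma taylor2_sin_pi4 (R : realType) (f : R -> R) (c1 c2 : R) :
  taylor2 f 0 c1 c2 ->
  taylor2 (fun a => sin (pi / 4 + f a)) (Num.sqrt 2 / 2)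
    (Num.sqrt 2 / 2 * c1) (Num.sqrt 2 / 2 * - (c1 ^+ 2 / 2 - c2)).
Proof.
move=> hf; apply: (taylor2_eq (taylor2Z (Num.sqrt 2 / 2)
  (taylor2D (taylor2_cos hf) (taylor2_sin hf)))) => [a|||].
- by rewrite sinD cos_pi4 sin_pi4; ring.
- by ring.
- by ring.
- by field.
Qed.

Lemma taylor2_line (R : realType) (k : R) : taylor2 (fun a => k * a) 0 k 0.
Proof. by apply: (taylor2_eq (taylor2_poly 0 k 0)) => // a; ring. Qed.

Lemma taylor2_arg (R : realType) (k l : R) :
  taylor2 (fun a => k * a + l * a ^+ 2) 0 k l.
Proof. by apply: (taylor2_eq (taylor2_poly 0 k l)) => // a; ring. Qed.

Lemma taylor2_cos_theta (R : realType) :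
  let q := Num.sqrt 2 / 2 in
  taylor2 (fun a : R => cos (theta a)) q (q * - cst_beta R)
    (q * - (cst_beta R ^+ 2 / 2)).
Proof.
apply: (taylor2_eq (taylor2_cos_pi4 (taylor2_line (cst_beta R)))) => //.
by rewrite addr0.
Qed.

Lemma taylor2_sin_theta (R : realType) :
  let q := Num.sqrt 2 / 2 in
  taylor2 (fun a : R => sin (theta a)) q (q * cst_beta R)
    (q * - (cst_beta R ^+ 2 / 2)).
Proof.
apply: (taylor2_eq (taylor2_sin_pi4 (taylor2_line (cst_beta R)))) => //.
by rewrite subr0.
Qed.

Lemma taylor2_cos_phi1 (R : realType) :
  let q := Num.sqrt 2 / 2 in
  taylor2 (fun a : R => cos (phi1 a)) q (q * - cst_gamma R)
    (q * - (cst_gamma R ^+ 2 / 2 + cst_delta R)).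
Proof.
have h := taylor2_arg (cst_gamma R) (cst_delta R).
by apply: (taylor2_eq (taylor2_cos_pi4 h)) => // a; rewrite addrA.
Qed.

Lemma taylor2_sin_phi1 (R : realType) :
  let q := Num.sqrt 2 / 2 in
  taylor2 (fun a : R => sin (phi1 a)) q (q * cst_gamma R)
    (q * - (cst_gamma R ^+ 2 / 2 - cst_delta R)).
Proof.
have h := taylor2_arg (cst_gamma R) (cst_delta R).
by apply: (taylor2_eq (taylor2_sin_pi4 h)) => // a; rewrite addrA.
Qed.

(** A quarter turn reduces [phi2] to an angle near [pi / 4] of the same shape as [phi1], with
    [delta] negated. *)
Lemma phi2E (R : realType) (a : R) :
  phi2 a = pi / 4 + (cst_gamma R * a + - cst_delta R * a ^+ 2) + pi / 2.
Proof. by rewrite /phi2; field. Qed.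

Lemma taylor2_cos_phi2 (R : realType) :
  let q := Num.sqrt 2 / 2 in
  taylor2 (fun a : R => cos (phi2 a)) (- q) (q * - cst_gamma R)
    (q * (cst_gamma R ^+ 2 / 2 + cst_delta R)).
Proof.
have h := taylor2_arg (cst_gamma R) (- cst_delta R).
apply: (taylor2_eq (taylor2Z (-1) (taylor2_sin_pi4 h))) => [a|||];
  try by field.
by rewrite phi2E cosDpihalf; ring.
Qed.

Lemma taylor2_sin_phi2 (R : realType) :
  let q := Num.sqrt 2 / 2 in
  taylor2 (fun a : R => sin (phi2 a)) q (q * - cst_gamma R)
    (q * - (cst_gamma R ^+ 2 / 2 - cst_delta R)).
Proof.
have h := taylor2_arg (cst_gamma R) (- cst_delta R).
by apply: (taylor2_eq (taylor2_cos_pi4 h)) => // a; rewrite phi2E sinDpihalf.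
Qed.

Lemma taylor2_radius (R : realType) :
  taylor2 (@radius R) (cst_s R) 0 (cst_K R).
Proof.
apply: (taylor2_eq (taylor2_poly (cst_s R) 0 (cst_K R))) => // a.
by rewrite /radius; ring.
Qed.

Lemma taylor2_sinBcos (R : realType) :
  taylor2 (fun a : R => sin (theta a) - cos (theta a))
    0 (8 + 20 * cst_s R ^+ 2) 0.
Proof.
apply: (taylor2_eq (taylor2D (taylor2_sin_theta R)
  (taylor2Z (-1) (taylor2_cos_theta R)))) => [a|||]; try by field.
rewrite cst_betaE.
transitivity (Num.sqrt 2 ^+ 2 * (4 + 10 * cst_s R ^+ 2)); first by field.
by rewrite sqr_sqrtr//; ring.
Qed.

(** The function is [2 - 2 cos(2 beta a)], whose leading term is [4 beta^2 a^2]. *)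
Lemma taylor2_cosMsin (R : realType) :
  taylor2 (fun a : R => 2 - 4 * cos (theta a) * sin (theta a))
    0 0 (288 + 640 * cst_s R ^+ 2).
Proof.
have q2 : Num.sqrt 2 ^+ 2 = 2 :> R by rewrite sqr_sqrtr.
apply: (taylor2_eq (taylor2D (taylor2_poly 2 0 0) (taylor2Z (-4)
  (taylor2M (taylor2_cos_theta R) (taylor2_sin_theta R))))) => [a|||].
- by ring.
- by transitivity (2 - Num.sqrt 2 ^+ 2 : R); [field | rewrite q2 subrr].
- by ring.
rewrite cst_betaE.
transitivity (2 * (Num.sqrt 2 ^+ 2) ^+ 2
  * (16 + 80 * cst_s R ^+ 2 + 100 * cst_s R ^+ 4)); first by field.
by rewrite q2 cst_s4; field.
Qed.

(** The terms of even order cancel, so [delta] drops out of the sum and survives only in the product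
    of the cosines. *)
Lemma taylor2_cosDcos (R : realType) :
  taylor2 (fun a : R => cos (phi1 a) + cos (phi2 a))
    0 (- (16 * cst_s R + 40 * cst_s R ^+ 3)) 0.
Proof.
apply: (taylor2_eq (taylor2D (taylor2_cos_phi1 R) (taylor2_cos_phi2 R))) => //;
  try by field.
rewrite cst_gammaE.
transitivity (- (Num.sqrt 2 ^+ 2 * (8 * cst_s R + 20 * cst_s R ^+ 3))).
  by field.
by rewrite sqr_sqrtr//; ring.
Qed.

(** The coefficient of [a^2] is [gamma^2 + delta]. *)
Lemma taylor2_cosMcos (R : realType) :
  taylor2 (fun a : R => cos (phi1 a) * cos (phi2 a))
    (- (1 / 2)) 0 (114 + 513 / 2 * cst_s R ^+ 2).
Proof.
have q2 : Num.sqrt 2 ^+ 2 = 2 :> R by rewrite sqr_sqrtr.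
apply: (taylor2_eq (taylor2M (taylor2_cos_phi1 R) (taylor2_cos_phi2 R))) => //.
- by transitivity (- (Num.sqrt 2 ^+ 2 / 4) : R); [field | rewrite q2; field].
- by field.
rewrite cst_gammaE cst_deltaE.
transitivity (Num.sqrt 2 ^+ 2 / 2 * (Num.sqrt 2 ^+ 2
  * (64 * cst_s R ^+ 2 + 320 * cst_s R ^+ 4
     + 400 * cst_s R ^+ 4 * cst_s R ^+ 2)
  + (- 14 - 63 / 2 * cst_s R ^+ 2))); first by field.
by rewrite q2 cst_s4; field.
Qed.

(** These equations determine the constants. At order [a], coefficients 1 and 3 give two linear
    equations for [beta] and [gamma]; at order [a^2], coefficient 0 gives [K] and coefficient 2
    gives [delta]; the constant term of coefficient 0 is [s^4 = 1/5]. The remaining orders up to 2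
    agree by themselves. *)
Lemma taylor2_coef (R : realType) (i : nat) : (i < 4)%N ->
  taylor2 (fun a : R => (qcoef a)`_i - (scoef a)`_i) 0 0 0.
Proof.
have s4 := cst_s4 R; set s := cst_s R in s4 *.
(* Reducing the higher powers of [s] makes the coefficient equations linear in [s], [s^2] and [s^3],
   within reach of [lra]. *)
have s5 : s ^+ 5 = s / 5 by rewrite exprSr s4; ring.
have s6 : s ^+ 6 = s ^+ 2 / 5 by rewrite 2!exprSr s4; ring.
have s7 : s ^+ 7 = s ^+ 3 / 5 by rewrite 3!exprSr s4; ring.
have hu := taylor2_sinBcos R; have hv := taylor2_cosMsin R.
have hc := taylor2_cosDcos R; have hcc := taylor2_cosMcos R.
have ha := taylor2_id R; have ha2 := taylor2M ha ha.
have ha3 := taylor2M ha ha2.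
have hr := taylor2_radius R; have hr2 := taylor2M hr hr.
rewrite /qcoef /scoef cst_KE -/s in hu hv hr hc hcc hr2 *.
case: i => [|[|[|[|]]]] //= _.
- apply: (taylor2_eq (taylor2D
    (taylor2D (taylor2_poly 5^-1 0 0)
      (taylor2D (taylor2Z (2 / 5) (taylor2M hu ha))
        (taylor2Z 5^-1 (taylor2D
          (taylor2D (taylor2M ha2 ha2) (taylor2Z 2 (taylor2M hu ha3)))
          (taylor2M hv ha2)))))
    (taylor2Z (-1) (taylor2M hr2 hr2)))) => [a|||]; first (by field); lra.
- apply: (taylor2_eq (taylor2D
    (taylor2Z (2 / 5) (taylor2D
      (taylor2D (taylor2Z 4 ha3) (taylor2Z 6 (taylor2M hu ha2)))
      (taylor2Z 2 (taylor2D (taylor2M hv ha) hu))))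
    (taylor2Z 2 (taylor2M (taylor2M hr2 hr) hc)))) => [a|||];
    first (by field); lra.
- apply: (taylor2_eq (taylor2D
    (taylor2Z (3 / 5) (taylor2D
      (taylor2D (taylor2Z 6 ha2) (taylor2Z 6 (taylor2M hu ha))) hv))
    (taylor2Z (-1) (taylor2D (taylor2Z 2 hr2)
      (taylor2Z 4 (taylor2M hr2 hcc)))))) => [a|||]; first (by field); lra.
- apply: (taylor2_eq (taylor2D
    (taylor2Z (4 / 5) (taylor2D (taylor2Z 4 ha) (taylor2Z 2 hu)))
    (taylor2Z 2 (taylor2M hr hc)))) => [a|||]; first (by field); lra.
Qed.

(** * Degrees, zeros and moduli *)

Lemma qpoly_monic (R : realType) (a : R) : qpoly a \is monic.
Proof. by rewrite qpoly_prod monic_prod_XsubC. Qed.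

Lemma size_qpoly (R : realType) (a : R) : size (qpoly a) = 6%N.
Proof. by rewrite qpoly_prod size_prod_XsubC. Qed.

Lemma root_qpoly (R : realType) (a : R) z : root (qpoly a) z = (z \in etas a).
Proof. by rewrite qpoly_prod root_prod_XsubC. Qed.

(** At 0 the quadratic factors are [X^2 - sqrt 2 X + 1] and [X^2 + sqrt 2 X + 1], with product
    [X^4 + 1]. *)
Lemma qpoly0 (R : realType) : qpoly (0 : R) = 'X^5 + 'X.
Proof.
rewrite qpoly_quad /theta mulr0 addr0 cos_pi4 sin_pi4.
have -> : 2 * (Num.sqrt 2 / 2) = Num.sqrt 2 :> R by field.
set c := (Num.sqrt 2)%:C%:P.
have c2 : c ^+ 2 = 2.
  by rewrite -!rmorphXn sqr_sqrtr// !rmorph_nat.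
by rewrite polyC0; ring: c2.
Qed.

Lemma monic_deriv (K : numFieldType) (p : {poly K}) (n : nat) :
  p \is monic -> size p = n.+2 ->
  n.+1%:R^-1 *: p^`() \is monic /\ size p^`() = n.+1.
Proof.
move=> pmon sp; have n0 : n.+1%:R != 0 :> K by rewrite pnatr_eq0.
have dn : p^`()`_n = n.+1%:R.
  by rewrite coef_deriv; have /monicP := pmon; rewrite lead_coefE sp => ->.
have sd : size p^`() = n.+1.
  apply/eqP; rewrite eqn_leq -ltnS -sp lt_size_deriv ?monic_neq0//=.
  by rewrite ltnNge; apply: contra_neqN n0 => /leq_sizeP/(_ n (leqnn _)) <-.
split=> //; apply/monicP.
by rewrite lead_coefE size_scale ?invr_eq0// sd coefZ dn mulVf.
Qed.

Lemma monic_qderiv (R : realType) (a : R) :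
  5^-1 *: (qpoly a)^`() \is monic.
Proof. by have [] := monic_deriv (qpoly_monic a) (size_qpoly a). Qed.

Lemma size_qderiv (R : realType) (a : R) : size (qpoly a)^`() = 5%N.
Proof. by have [] := monic_deriv (qpoly_monic a) (size_qpoly a). Qed.

Lemma chi1E (R : realType) (a : R) :
  chi1 a = (a + radius a * cos (phi1 a)) +i* (radius a * sin (phi1 a)).
Proof. by rewrite /chi1 /expi; simpc. Qed.

Lemma chi2E (R : realType) (a : R) :
  chi2 a = (a + radius a * cos (phi2 a)) +i* (radius a * sin (phi2 a)).
Proof. by rewrite /chi2 /expi; simpc. Qed.

Lemma qpoly_class (R : realType) (a : R) :
  0 <= a <= 1 -> sendov_class 5 (qpoly a).
Proof.
move=> /andP[a0 a1]; split; [exact: qpoly_monic | exact: size_qpoly |].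
move=> z; rewrite root_qpoly !inE.
case/or4P => [/eqP->|/eqP->|/eqP->|/orP[]/eqP->].
- by rewrite modc_real ger0_norm.
- by rewrite modc_expi.
- by rewrite modcM modc_i mul1r modc_expi.
- by rewrite modc_conj modc_expi.
- by rewrite modcN modcM modc_i mul1r modc_conj modc_expi.
Qed.

Lemma modc_chi_sub (R : realType) (a : R) (z : R[i]) :
  z \in chis a -> modc (z - a%:C) = `|radius a|.
Proof.
move=> zc.
have conjE t : (a%:C + (radius a)%:C * expi t)^*%C - a%:C
    = (radius a)%:C * (expi t)^*%C.
  by rewrite /expi; simpc; rewrite [a + _]addrC addrK.
move: zc; rewrite !inE => /or4P[] /eqP->.
- by rewrite addrC addKr modcM modc_real modc_expi mulr1.
- by rewrite addrC addKr modcM modc_real modc_expi mulr1.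
- by rewrite conjE modcM modc_real modc_conj modc_expi mulr1.
- by rewrite conjE modcM modc_real modc_conj modc_expi mulr1.
Qed.

(** * Locating the critical points of [q_a] *)

Lemma qderiv_chi (R : realType) :
  exists2 C : R, 0 < C & \forall a \near (0 : R), forall z, z \in chis a ->
    modc (5^-1 *: (qpoly a)^`()).[z] <= C * `|a| ^+ 3.
Proof.
have /fin_all_exists[C hC] (i : 'I_4) : exists C : R, 0 < C /\
    \forall a \near (0 : R), `|(qcoef a)`_i - (scoef a)`_i| <= C * `|a| ^+ 3.
  by have [C C0 ?] := taylor2_O3 (taylor2_coef R (ltn_ord i)); exists C.
have e0 : 0 < 1 / 4 :> R by lra.
have hr := taylor2_continuous e0 (taylor2_radius R).
exists (\sum_i C i).
  rewrite big_ord_recl ltr_pwDl//; first exact: (hC _).1.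
  by apply: sumr_ge0 => i _; exact: ltW (hC _).1.
have hCa : \forall a \near (0 : R), forall i : 'I_4,
    `|(qcoef a)`_i - (scoef a)`_i| <= C i * `|a| ^+ 3.
  exact: (filter_forall _ (fun i => (hC i).2)).
near=> a => z zc; have /andP[s0 s1] := cst_s_bounds R.
have r1 : `|radius a| <= 1.
  have : `|radius a - cst_s R| < 1 / 4 by near: a; exact: hr.
  by rewrite ltr_norml => /andP[? ?]; rewrite ler_norml; apply/andP; split; lra.
(* Subtracting the vanishing value of [s_a / 5] cancels [(z - a)^4] and leaves only coefficient
   differences, weighted by powers of modulus at most 1. *)
have -> : (5^-1 *: (qpoly a)^`()).[z]
    = \sum_(i < 4) ((qcoef a)`_i - (scoef a)`_i)%:C * (z - a%:C) ^+ i.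
  rewrite -[LHS]subr0 -[X in _ - X = _](scoef_root zc) qpoly_deriv_horner.
  rewrite opprD addrACA subrr add0r -sumrB; apply: eq_bigr => i _.
  by rewrite -mulrBl -rmorphB.
rewrite mulr_suml (le_trans (modc_sum _))// ler_sum// => i _.
have hi : `|(qcoef a)`_i - (scoef a)`_i| <= C i * `|a| ^+ 3.
  by move: i; near: a.
rewrite modcM modc_real (le_trans _ hi)// ler_piMr// modcX (modc_chi_sub zc).
by rewrite exprn_ile1.
Unshelve. all: by end_near. Qed.

(* At [a = 0] the zeros of [qpoly] other than [0] are the points
   [(+-1 +- i)/sqrt 2], and those of its derivative are [s] times these. *)
Definition well_placed {R : realType} (a : R) : Prop :=
  [/\ 13 / 20 < radius a < 7 / 10,
      2 / 3 < cos (theta a) < 5 / 7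
      /\ 2 / 3 < sin (theta a) < 5 / 7,
      9 / 20 < complex.Re (chi1 a) < 1 / 2
      /\ 9 / 20 < complex.Im (chi1 a) < 1 / 2
    & - (1 / 2) < complex.Re (chi2 a) < - (9 / 20)
      /\ 9 / 20 < complex.Im (chi2 a) < 1 / 2].

Lemma taylor2_near_itv (R : realType) (f : R -> R) (c0 c1 c2 l u : R) :
  taylor2 f c0 c1 c2 -> l < c0 < u -> \forall a \near (0 : R), l < f a < u.
Proof.
move=> hf /andP[lc cu].
have e0 : 0 < Num.min (c0 - l) (u - c0) by rewrite lt_min !subr_gt0 lc.
apply: filterS (taylor2_continuous e0 hf) => a.
rewrite lt_min !ltr_norml => /andP[/andP[? ?] /andP[? ?]].
by apply/andP; split; lra.
Qed.

(** Only the value at 0 matters for the localisation, so the other coefficients stay existential. *)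
Lemma taylor2_Re_chi1 (R : realType) : exists c1 c2 : R,
  taylor2 (fun a => complex.Re (chi1 a)) (cst_s R * (Num.sqrt 2 / 2)) c1 c2.
Proof.
have hr := taylor2_radius R.
have ha := taylor2_id R.
do 2 eexists.
apply: (taylor2_eq (taylor2D ha (taylor2M hr (taylor2_cos_phi1 R)))) => [a|||].
- by rewrite chi1E.
- by rewrite add0r.
- reflexivity.
- reflexivity.
Qed.

Lemma taylor2_Im_chi1 (R : realType) : exists c1 c2 : R,
  taylor2 (fun a => complex.Im (chi1 a)) (cst_s R * (Num.sqrt 2 / 2)) c1 c2.
Proof.
have hr := taylor2_radius R.
do 2 eexists; apply: (taylor2_eq (taylor2M hr (taylor2_sin_phi1 R))) => [a|||].
- by rewrite chi1E.
- reflexivity.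
- reflexivity.
- reflexivity.
Qed.

Lemma taylor2_Re_chi2 (R : realType) : exists c1 c2 : R,
  taylor2 (fun a => complex.Re (chi2 a)) (cst_s R * (- (Num.sqrt 2 / 2))) c1 c2.
Proof.
have hr := taylor2_radius R.
have ha := taylor2_id R.
do 2 eexists.
apply: (taylor2_eq (taylor2D ha (taylor2M hr (taylor2_cos_phi2 R)))) => [a|||].
- by rewrite chi2E.
- by rewrite add0r.
- reflexivity.
- reflexivity.
Qed.

Lemma taylor2_Im_chi2 (R : realType) : exists c1 c2 : R,
  taylor2 (fun a => complex.Im (chi2 a)) (cst_s R * (Num.sqrt 2 / 2)) c1 c2.
Proof.
have hr := taylor2_radius R.
do 2 eexists; apply: (taylor2_eq (taylor2M hr (taylor2_sin_phi2 R))) => [a|||].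
- by rewrite chi2E.
- reflexivity.
- reflexivity.
- reflexivity.
Qed.

Lemma near_well_placed (R : realType) : \forall a \near (0 : R), well_placed a.
Proof.
have hr := taylor2_radius R.
have /andP[s0 s1] := cst_s_bounds R; have /andP[q0 q1] := sqrt2_bounds R.
(* The coordinates of the [chi] at 0 are [s / sqrt 2] up to sign; the two products are [7/15 > 9/20]
   and [1/2]. *)
have lo : 2 / 3 * (7 / 10) < cst_s R * (Num.sqrt 2 / 2).
  by apply: ltr_pM; lra.
have hi : cst_s R * (Num.sqrt 2 / 2) < 7 / 10 * (5 / 7).
  by apply: ltr_pM; lra.
have hradius : \forall a \near (0 : R), 13 / 20 < radius a < 7 / 10.
  by apply: taylor2_near_itv hr _; lra.
have hcos : \forall a \near (0 : R), 2 / 3 < cos (theta a) < 5 / 7.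
  by apply: taylor2_near_itv (taylor2_cos_theta R) _; lra.
have hsin : \forall a \near (0 : R), 2 / 3 < sin (theta a) < 5 / 7.
  by apply: taylor2_near_itv (taylor2_sin_theta R) _; lra.
have hRe1 : \forall a \near (0 : R),
    9 / 20 < complex.Re (chi1 a) < 1 / 2.
  by have [c1 [c2 h]] := taylor2_Re_chi1 R; apply: taylor2_near_itv h _; lra.
have hIm1 : \forall a \near (0 : R),
    9 / 20 < complex.Im (chi1 a) < 1 / 2.
  by have [c1 [c2 h]] := taylor2_Im_chi1 R; apply: taylor2_near_itv h _; lra.
have hRe2 : \forall a \near (0 : R),
    - (1 / 2) < complex.Re (chi2 a) < - (9 / 20).
  by have [c1 [c2 h]] := taylor2_Re_chi2 R; apply: taylor2_near_itv h _; lra.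
have hIm2 : \forall a \near (0 : R),
    9 / 20 < complex.Im (chi2 a) < 1 / 2.
  by have [c1 [c2 h]] := taylor2_Im_chi2 R; apply: taylor2_near_itv h _; lra.
by near=> a; split; [|split|split|split]; near: a.
Unshelve. all: by end_near. Qed.

(** The points lie in four different quadrants with coordinates beyond [9/20] in absolute value, so
    two of them differ by more than [9/10] in some coordinate. The bound is [3 m] for the [m = 1/4]
    fed to [monic_zeros_near]. *)
Lemma chis_separated (R : realType) (a : R) i j :
  well_placed a -> (i < j < 4)%N ->
  3 * 4^-1 <= modc ((chis a)`_i - (chis a)`_j).
Proof.
case=> _ _; rewrite /chis; move: (chi1 a) (chi2 a) => [x1 y1] [x2 y2] /=.
move=> [/andP[? ?] /andP[? ?]] [/andP[? ?] /andP[? ?]] ij.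
have hRe (u v : R) : 3 / 4 <= `|u| -> 3 / 4 <= modc (u +i* v).
  by move/le_trans; apply; exact: modc_Re (u +i* v).
have hIm (u v : R) : 3 / 4 <= `|v| -> 3 / 4 <= modc (u +i* v).
  by move/le_trans; apply; exact: modc_Im (u +i* v).
move: i j ij => [|[|[|[|i]]]] [|[|[|[|j]]]]; rewrite ?ltnS ?ltn0 ?andbF//= => _.
- by apply: hRe; rewrite ger0_norm; lra.
- by apply: hIm; rewrite ger0_norm; lra.
- by apply: hRe; rewrite ger0_norm; lra.
- by apply: hRe; rewrite ler0_norm; lra.
- by apply: hIm; rewrite ger0_norm; lra.
- by apply: hRe; rewrite ger0_norm; lra.
Qed.

Lemma near0_cube_lt (R : realType) (C e : R) : 0 < C -> 0 < e ->
  \forall a \near (0 : R), C * `|a| ^+ 3 < e.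
Proof.
move=> C0 e0.
near=> a.
have a1 : `|a| < 1 by near: a; apply: (nbhs0_lt (V := R)).
have a2 : `|a| < e / C by near: a; apply: (nbhs0_lt (V := R)); rewrite divr_gt0.
apply: (@le_lt_trans _ _ (C * `|a|)).
  by rewrite ler_pM2l// exprS ler_piMr// exprn_ile1// ltW.
by rewrite mulrC -ltr_pdivlMr.
Unshelve. all: by end_near. Qed.

Lemma near_qderiv_zeros (R : realType) :
  exists2 C : R, 0 < C & \forall a \near (0 : R),
    [/\ well_placed a, C * `|a| ^+ 3 < 1 / 50 & exists ws,
      [/\ size ws = 4, 5^-1 *: (qpoly a)^`() = \prod_(w <- ws) ('X - w%:P) &
        forall i, (i < 4)%N -> modc ((chis a)`_i - ws`_i) <= C * `|a| ^+ 3]].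
Proof.
have [C C0 hC] := qderiv_chi R.
(* The factor is the [1 / m^3] of [monic_zeros_near] at [m = 1/4]. *)
exists (C * 4 ^+ 3); first by rewrite mulr_gt0 ?exprn_gt0.
near=> a.
have wp : well_placed a by near: a; exact: near_well_placed.
have small : C * `|a| ^+ 3 < 4^-1 ^+ 4.
  by near: a; apply: near0_cube_lt; rewrite ?exprn_gt0 ?invr_gt0.
have hCa z : z \in chis a -> modc (5^-1 *: (qpoly a)^`()).[z] <= C * `|a| ^+ 3.
  by move: z; near: a.
split=> //; first by near: a; apply: near0_cube_lt; rewrite ?mulr_gt0; lra.
have [||||ws [sws PE hws]] := monic_zeros_near (cs := chis a)
    (m := 4^-1) (e := C * `|a| ^+ 3) (monic_qderiv a) _ _ _ _ small.
- by rewrite size_scale ?invr_eq0 ?pnatr_eq0// size_qderiv.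
- by rewrite invr_gt0.
- by move=> i j ij; exact: chis_separated.
- by move=> i ni; apply: hCa; rewrite mem_nth.
exists ws; split=> // i /hws; rewrite /= => /le_trans; apply.
by rewrite le_eqVlt; apply/orP; left; apply/eqP; field.
Unshelve. all: by end_near. Qed.

(** * Distances for [q_a] and conclusion *)

Lemma modc_eta_sub (R : realType) :
  exists2 C : R, 0 < C &
    \forall a \near (0 : R), modc (eta a - eta 0) <= C * `|a|.
Proof.
have [C C0 hC] := taylor2_near (taylor2_cos_theta R).
have [D D0 hD] := taylor2_near (taylor2_sin_theta R).
exists (C + D); first exact: addr_gt0.
apply: filterS2 hC hD => a; rewrite -{1}cos_pi4 -sin_pi4 => hC hD.
rewrite mulrDl (le_trans _ (lerD hC hD))//.
by rewrite /eta /expi mulr0 addr0 modc_le_ReIm.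
Qed.

Lemma near_zeros_dist_qpoly (R : realType) :
  exists2 C : R, 0 < C &
    \forall a \near (0 : R), zeros_dist (qpoly a) ('X^5 + 'X) <= C * `|a|.
Proof.
have [C C0 hC] := modc_eta_sub R.
(* The 1 accounts for the zero [a], the [C] for the four zeros built from [eta a]. *)
exists (1 + C); first by rewrite addr_gt0.
apply: filterS hC => a; rewrite -[1]/(1 : R).
have := normr_ge0 a; have Ca : 0 <= C * `|a| by rewrite mulr_ge0// ltW.
move=> a0 hE.
have {hE} : modc (eta a - eta 0) <= (1 + C) * `|a| by lra.
have {Ca} : `|a| <= (1 + C) * `|a| by lra.
move: ((1 + C) * _) => e ae hE.
rewrite -qpoly0 !qpoly_prod; apply: zeros_dist_le => //; first lra.
have conjB : modc ((eta a)^*%C - (eta 0)^*%C) <= e.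
  by rewrite -rmorphB modc_conj.
have realB : modc (a%:C - (0 : R)%:C) <= e.
  by rewrite subr0 modc_real.
have iB : modc ('i%C * eta a - 'i%C * eta 0) <= e.
  by rewrite -mulrBr modcM modc_i mul1r.
have iconjB : modc (- ('i%C * (eta a)^*%C) - - ('i%C * (eta 0)^*%C)) <= e.
  by rewrite -opprD modcN -mulrBr modcM modc_i mul1r.
by case=> [|[|[|[|[|]]]]].
Qed.

(** Each coordinate differs by less than [5/7 - 9/20], and twice that is below [53/100]. This is
    cruder than the distance [1 - s] at [a = 0], but still small enough compared with [s]. *)
Lemma etas_close (R : realType) (a : R) (z : R[i]) :
  well_placed a -> z \in etas a ->
  z = a%:C \/ exists2 i, (i < 4)%N & modc (z - (chis a)`_i) <= 53 / 100.
Proof.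
case=> _; rewrite /chis /etas /eta /expi -/(theta a).
move: (chi1 a) (chi2 a) (cos _) (sin _) => [x1 y1] [x2 y2] x y /=.
move=> [/andP[? ?] /andP[? ?]] [/andP[? ?] /andP[? ?]] [/andP[? ?] /andP[? ?]].
have close1 : modc ((x +i* y) - (x1 +i* y1)) <= 53 / 100.
  apply: le_trans (modc_le_ReIm _) _ => /=.
  by rewrite !ger0_norm; lra.
have close2 : modc ('i%C * (x +i* y) - (x2 +i* y2)) <= 53 / 100.
  apply: le_trans (modc_le_ReIm _) _ => /=.
  rewrite ler0_norm; last lra.
  by rewrite ger0_norm; lra.
have conjB (u v : R[i]) : modc (u^*%C - v^*%C) = modc (u - v).
  by rewrite -rmorphB modc_conj.
rewrite !inE; case/or4P => [/eqP->|/eqP->|/eqP->|/orP[]/eqP->].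
- by left.
- by right; exists 0%N.
- by right; exists 1%N.
- by right; exists 2%N => //; rewrite (conjB (x +i* y) (x1 +i* y1)).
- right; exists 3%N => //.
  have -> : - ('i%C * (x -i* y)) = ('i%C * (x +i* y))^*%C by simpc.
  by rewrite (conjB _ (x2 +i* y2)).
Qed.

Lemma near_crit_dist_qpoly (R : realType) :
  exists2 C : R, 0 < C & \forall a \near (0 : R),
    `|crit_dist (qpoly a) a%:C - (cst_s R + cst_K R * a ^+ 2)| <= C * `|a| ^+ 3
    /\ sendov_dist (qpoly a) = crit_dist (qpoly a) a%:C.
Proof.
have [C C0 hC] := near_qderiv_zeros R; exists C => //.
apply: filterS hC => a [wp]; move: (C * _) => e e50 [ws [sws PE hws]].
have q0 : qpoly a != 0 by rewrite monic_neq0 ?qpoly_monic.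
have dq0 : (qpoly a)^`() != 0 by rewrite -size_poly_gt0 size_qderiv.
have rootP w : root (qpoly a)^`() w = (w \in ws).
  by rewrite -root_prod_XsubC -PE rootZ// invr_eq0 pnatr_eq0.
have ws_root i : (i < 4)%N -> root (qpoly a)^`() ws`_i.
  by move=> i4; rewrite rootP mem_nth ?sws.
have [/andP[r0 r1] _ _ _] := wp.
have chi_dist i : (i < 4)%N -> modc (a%:C - (chis a)`_i) = radius a.
  move=> i4; rewrite modcB modc_chi_sub ?mem_nth// ger0_norm//.
  by by apply: le_trans _ (ltW r0); lra.
have crit_le : crit_dist (qpoly a) a%:C <= radius a + e.
  apply: le_trans (crit_dist_le _ dq0 (ws_root 0%N isT)) _.
  apply: le_trans (modcB_le _ (chis a)`_0 _) _.
  by rewrite chi_dist// lerD2l hws.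
have crit_ge : radius a - e <= crit_dist (qpoly a) a%:C.
  apply: crit_dist_ge => [|w]; first by rewrite size_qderiv.
  rewrite rootP => wws; have := wws; rewrite -index_mem sws => i4.
  rewrite -(nth_index 0 wws); set i := index w ws in i4 *.
  rewrite lerBlDr -(chi_dist i i4).
  by apply: le_trans (modcB_le _ ws`_i _) _; rewrite lerD2l modcB hws.
split; first by rewrite -/(radius a) ler_distl lerBlDr -lerBlDr crit_ge.
apply/eqP; rewrite eq_le sendov_dist_ge ?root_qpoly ?mem_head// andbT.
apply: sendov_dist_le => //; first exact: crit_dist_ge0.
move=> z; rewrite root_qpoly => /(etas_close wp)[->//|[i i4 zi]].
apply: le_trans (crit_dist_le _ dq0 (ws_root i i4)) _.
apply: le_trans (modcB_le _ (chis a)`_i _) _.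
apply: le_trans (lerD zi (hws i i4)) _.
(* [53/100 + 1/50] is less than [13/20 - 1/50], which bounds [radius a - e] from below. *)
by apply: le_trans _ crit_ge; lra.
Qed.

Lemma near_zeros_dist_qderiv (R : realType) :
  exists2 C : R, 0 < C & \forall a \near (0 : R),
    zeros_dist (5^-1 *: (qpoly a)^`()) (5^-1 *: spoly a) <= C * `|a| ^+ 3.
Proof.
have [C C0 hC] := near_qderiv_zeros R; exists C => //.
apply: filterS hC => a [_ _ [ws [sws -> hws]]]; rewrite spoly_prod.
apply: zeros_dist_le; rewrite ?sws//.
  by rewrite mulr_ge0 ?exprn_ge0// ltW.
by move=> i i4; rewrite modcB hws.
Qed.

Lemma cst_K_gt0 (R : realType) : 0 < cst_K R.
Proof.
have /andP[s0 _] := cst_s_bounds R; rewrite cst_KE.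
by have := exprn_gt0 3 (lt_trans _ s0); lra.
Qed.

Lemma near_right (R : realType) (P : R -> Prop) :
  (\forall a \near (0 : R), P a) -> \forall a \near (0 : R)^'+, P a.
Proof. exact: cvg_within. Qed.

(** At [a = 0] the error [C |a|^3] vanishes, so the estimate becomes an equality. *)
Lemma sendov_dist_X5DX (R : realType) :
  sendov_dist ('X^5 + 'X : {poly R[i]}) = cst_s R.
Proof.
have [C C0 /nbhs_singleton[]] := near_crit_dist_qpoly R.
rewrite -qpoly0 => hC ->; move: hC.
by rewrite normr0 !expr0n !mulr0 addr0 normr_le0 subr_eq0 => /eqP.
Qed.

Theorem theorem8 (R : realType) :
  (forall a : R, 0 <= a <= 1 -> sendov_class 5 (qpoly a))
  /\ (fun a : R => zeros_dist (qpoly a) ('X^5 + 'X))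
       =O_ ((0 : R)^'+) (fun a : R => a)
  /\ (fun a : R => zeros_dist (5^-1 *: (qpoly a)^`()) (5^-1 *: spoly a))
       =O_ ((0 : R)^'+) (fun a : R => a ^+ 3)
  /\ (\forall a \near (0 : R)^'+,
        sendov_dist (qpoly a) = crit_dist (qpoly a) a%:C)
  /\ (fun a : R => crit_dist (qpoly a) a%:C)
       = (fun a : R => cst_s R + cst_K R * a ^+ 2)
       +O_ ((0 : R)^'+) (fun a : R => a ^+ 3)
  /\ sendov_class 5 ('X^5 + 'X : {poly R[i]})
  /\ ~ locally_maximal 5 ('X^5 + 'X : {poly R[i]}).
Proof.
have [C1 C1gt0 hC1] := near_zeros_dist_qpoly R.
have [C2 C2gt0 hC2] := near_zeros_dist_qderiv R.
have [C3 C3gt0 hC3] := near_crit_dist_qpoly R.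
split; first exact: qpoly_class.
split.
  apply/eqO_exP; exists C1 => //; apply: near_right; apply: filterS hC1 => a.
  by rewrite (ger0_norm (zeros_dist_ge0 _ _)).
split.
  apply/eqO_exP; exists C2 => //; apply: near_right; apply: filterS hC2 => a.
  by rewrite normrX (ger0_norm (zeros_dist_ge0 _ _)).
split; first by apply: near_right; apply: filterS hC3 => a [].
split.
  (* The Landau notation asks for the bound with all large enough constants; those above [C3]
     qualify. *)
  apply/eqaddOP; apply: filterS (nbhs_pinfty_ge (num_real C3)) => k Ck.
  apply: near_right; apply: filterS hC3 => a [h _].
  by apply: (le_trans h); rewrite normrX ler_wpM2r ?exprn_ge0.
split; first by rewrite -qpoly0; apply: qpoly_class; rewrite lexx ler01.
case=> eps eps0 maxp; have K0 := cst_K_gt0 R.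
(* Right neighbourhoods of 0 are nonempty, so a contradiction for all small [a > 0] suffices. *)
have : \forall a \near (0 : R)^'+, False; last by case/filter_ex.
near=> a.
have a0 : 0 < a by near: a; exact: nbhs_right_gt.
have a1 : a < 1 by near: a; exact: nbhs_right_lt.
have ae : a < eps / C1 by near: a; apply: nbhs_right_lt; rewrite divr_gt0.
(* This makes the error [C3 a^3] smaller than the gain [K a^2]. *)
have aK : a < cst_K R / C3 by near: a; apply: nbhs_right_lt; rewrite divr_gt0.
have close : zeros_dist (qpoly a) ('X^5 + 'X) < eps.
  apply: (@le_lt_trans _ _ (C1 * `|a|)).
    by near: a; exact: near_right.
  by rewrite gtr0_norm// mulrC -ltr_pdivlMr.
have a01 : 0 <= a <= 1 by rewrite !ltW.
have := maxp _ (qpoly_class a01) close.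
have [h ->] : `|crit_dist (qpoly a) a%:C - (cst_s R + cst_K R * a ^+ 2)|
    <= C3 * `|a| ^+ 3 /\ sendov_dist (qpoly a) = crit_dist (qpoly a) a%:C.
  by near: a; exact: near_right.
apply/negP; rewrite -ltNge sendov_dist_X5DX.
move: h; rewrite ler_distl => /andP[h _]; apply: lt_le_trans h.
rewrite -addrA ltrDl subr_gt0 gtr0_norm// exprS mulrA ltr_pM2r ?exprn_gt0//.
by rewrite mulrC -ltr_pdivlMr.
Unshelve. all: by end_near. Qed.
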